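(* Let $(X,c)$ be a session coalgebra and consider the session type system for $\pi$-calculus processes with channel types in $X$. Let $\Gamma$ and $\Delta$ be contexts such that $\Delta$ simulates $\Gamma$, i.e., $\mathrm{dom}(\Delta)=\mathrm{dom}(\Gamma)$ and $\Delta(x)\sqsubseteq\Gamma(x)$ for every $x$ in this domain. Then for every process $P$, $\Gamma\vdash P$ implies $\Delta\vdash P$.
   Context: Session coalgebra: fix basic data types $D$ with a decidable preorder $\le_D$ and labels $\mathbb{L}$. A session coalgebra is a set $X$ with $c(x)=(\sigma(x),\delta(x))$, $\sigma(x)$ one of $(\mathrm{com},p)$ ($p\in\{\mathrm{in},\mathrm{out}\}$), $(\mathrm{branch},p,L)$ ($L\subseteq\mathbb{L}$ finite nonempty), $\mathrm{end}$, $(\mathrm{bsc},d)$ ($d\in D$), $\mathrm{par}$; and $\delta(x)\colon B_{\sigma(x)}\to X$ with $B_{(\mathrm{com},p)}=\{*,1\}$, $B_{(\mathrm{branch},p,L)}=L$, $B_{\mathrm{end}}=B_{(\mathrm{bsc},d)}=\emptyset$, $B_{\mathrm{par}}=\{*\}$. Abbreviations: $?=(\mathrm{com},\mathrm{in})$, $!=(\mathrm{com},\mathrm{out})$. Bisimilarity $\sim$: greatest $R\subseteq X\times X$ such that for $(x,y)\in R$ either $\sigma(x)=\sigma(y)$ and $\delta(x)(\alpha)\,R\,\delta(y)(\alpha)$ for all $\alpha$, or $\sigma(x)=(\mathrm{bsc},d),\sigma(y)=(\mathrm{bsc},d')$ with $d\le_D d'$ and $d'\le_D d$. Parallelizability: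 $Y\subseteq X$ is parallelizable if closed under all transitions and for all $u,w\in Y$: $u\sim w$ or $\sigma(u)=\mathrm{par}$ or $\sigma(w)=\mathrm{par}$. A state $x$ is parallelizable, $\mathrm{par}(x)$, if the least set containing $x$ and closed under continuation transitions (the transition $*$ of com states, all transitions of other states) is parallelizable. Similarity $\sqsubseteq$: greatest $R$ such that each $(x,y)\in R$ satisfies one of: $\sigma(x)=\sigma(y)=(\mathrm{com},\mathrm{in})$, $\delta(x)( * )R\delta(y)( * )$, $\delta(x)(1)R\delta(y)(1)$; $\sigma(x)=\sigma(y)=(\mathrm{com},\mathrm{out})$, $\delta(x)( * )R\delta(y)( * )$, $\delta(y)(1)R\delta(x)(1)$; $\sigma(x)=(\mathrm{branch},\mathrm{in},L_1)$, $\sigma(y)=(\mathrm{branch},\mathrm{in},L_2)$, $L_1\subseteq L_2$, $\delta(x)(l)R\delta(y)(l)$ for $l\in L_1$; $\sigma(x)=(\mathrm{branch},\mathrm{out},L_1)$, $\sigma(y)=(\mathrm{branch},\mathrm{out},L_2)$, $L_2\subseteq L_1$, $\delta(x)(l)R\delta(y)(l)$ for $l\in L_2$; $\sigma(x)=(\mathrm{bsc},d),\sigma(y)=(\mathrm{bsc},d')$, $d\le_D d'$; $\sigma(x)=\sigma(y)=\mathrm{end}$; $\sigma(x)=\sigma(y)=\mathrm{par}$, $\delta(x)( * )R\delta(y)( * )$ and $\mathrm{par}(\delta(x)( * ))$ iff $\mathrm{par}(\delta(y)( * ))$. Duality $\bot$: greatest $R$ such that for $(x,y)\in R$: $\sigma(y)=\overline{\sigma(x)}$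 where $\overline{(\mathrm{com},p)}=(\mathrm{com},\overline p)$, $\overline{(\mathrm{branch},p,L)}=(\mathrm{branch},\overline p,L)$, $\overline{\mathrm{end}}=\mathrm{end}$, $\overline{\mathrm{par}}=\mathrm{par}$, $\overline{\mathrm{in}}=\mathrm{out}$, $\overline{\mathrm{out}}=\mathrm{in}$ (no bsc state has a dual); $\delta(x)(\alpha)R\delta(y)(\alpha)$ for continuation labels $\alpha$; $\delta(x)(1)\sim\delta(y)(1)$ for com states. Processes: $P,Q::=\overline{x}\langle y\rangle.P\mid x(y).P\mid x\rhd\{l_i:P_i\}_{i\in I}\mid x\lhd l.P\mid P\mid Q\mid\ !P\mid\mathbf{0}\mid(\nu xy)P$. A context $\Gamma$ is a finite set of pairs $x:T$ ($T\in X$) with at most one pair per variable, viewed as a partial function; $\Gamma,x:T$ presupposes $x\notin\mathrm{dom}(\Gamma)$. $\mathrm{un}(T)$ if $\sigma(T)\in\{\mathrm{par},\mathrm{end}\}$ or $\sigma(T)=(\mathrm{bsc},d)$; $\mathrm{un}(\Gamma)$ if all its types are unrestricted. Context split $\Gamma=\Gamma_1\circ\Gamma_2$ is the least relation with $\emptyset=\emptyset\circ\emptyset$ and, if $\Gamma=\Gamma_1\circ\Gamma_2$: $\Gamma,x:T=(\Gamma_1,x:T)\circ(\Gamma_2,x:T)$ when $\mathrm{un}(T)$; $\Gamma,x:T=(\Gamma_1,x:T)\circ\Gamma_2$; $\Gamma,x:T=\Gamma_1\circ(\Gamma_2,x:T)$. Typing rules: (Inact) $\mathrm{un}(\Gamma)\Rightarrow\Gamma\vdash\mathbf{0}$;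 (Res) $\Gamma,x:T,y:U\vdash P$, $T\bot U\Rightarrow\Gamma\vdash(\nu xy)P$; (Par) $\Gamma_1\vdash P$, $\Gamma_2\vdash Q\Rightarrow\Gamma_1\circ\Gamma_2\vdash P\mid Q$; (Rep) $\Gamma\vdash P$, $\mathrm{un}(\Gamma)\Rightarrow\Gamma\vdash\,!P$; (In) $\sigma(T)=?$, $f=\delta(T)$, $\Gamma,y:U,x:f( * )\vdash P$, $f(1)\sqsubseteq U\Rightarrow\Gamma,x:T\vdash x(y).P$; (Out) $\sigma(T)=!$, $f=\delta(T)$, $\Gamma,x:f( * )\vdash P$, $U\sqsubseteq f(1)\Rightarrow\Gamma,x:T,y:U\vdash\overline{x}\langle y\rangle.P$; (Branch) $\sigma(T)=(\mathrm{branch},\mathrm{in},L_1)$, $f=\delta(T)$, $L_1\subseteq L_2$, $\Gamma,x:f(l)\vdash P_l$ for all $l\in L_1\Rightarrow\Gamma,x:T\vdash x\rhd\{l:P_l\}_{l\in L_2}$; (Sel) $\sigma(T)=(\mathrm{branch},\mathrm{out},L)$, $f=\delta(T)$, $l\in L$, $\Gamma,x:f(l)\vdash P_l\Rightarrow\Gamma,x:T\vdash x\lhd l.P_l$; (Unpack) $\sigma(T)=\mathrm{par}$, $\mathrm{par}(T)$, $\Gamma,x:\delta(T)( * )\vdash P\Rightarrow\Gamma,x:T\vdash P$.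
   Formalization: A parallelizable set is required to be closed under continuation transitions only, not under all transitions, since the claim fails otherwise; data types, labels and variables are assumed to have decidable equality and choice, as always holds classically. *)

(* Defs.v *)
From mathcomp Require Import all_boot all_order finmap.

Set Implicit Arguments.
Unset Strict Implicit.
Unset Printing Implicit Defensive.

Local Open Scope order_scope.
Local Open Scope fset_scope.
Local Open Scope fmap_scope.

(* Greatest relation R such that R u v implies F R u v.  For monotone F, as
   are all the clauses below, the union of all such R is again such an R. *)
Definition greatest (X : Type) (F : (X -> X -> Prop) -> X -> X -> Prop)
    (x y : X) : Prop :=
  exists2 R : X -> X -> Prop, (forall u v, R u v -> F R u v) & R x y.

Inductive polarity := In | Out.

Definition dual_pol (p : polarity) : polarity :=
  match p with In => Out | Out => In end.

(* The two transition labels of a communication: [Star] is the continuation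
   and [One] the transmitted type. *)
Inductive com_label := Star | One.

Section SessionCoalgebra.
Context {disp : Order.disp_t} {D : preorderType disp} {Lab : choiceType}.

Inductive session_op : Type :=
| Com of polarity
| Branch of polarity & {L : {fset Lab} | L != fset0}
| End
| Bsc of D
| Par.

(* The coercion of [val L : {fset Lab}] to a type is that of its elements. *)
Definition arity (s : session_op) : Type :=
  match s with
  | Com _ => com_label
  | Branch _ L => val L
  | End | Bsc _ => Empty_set
  | Par => unit
  end.

Definition is_continuation (s : session_op) : arity s -> Prop :=
  match s return arity s -> Prop with
  | Com _ => fun a => a = Star
  | _ => fun _ => True
  end.
End SessionCoalgebra.

Arguments session_op {disp} D Lab.

(* [step x] is the pair of sigma(x) and delta(x). *)
Record session_coalgebra (disp : Order.disp_t) (D : preorderType disp)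
    (Lab : choiceType) := SessionCoalgebra {
  state :> Type;
  step : state -> {s : session_op D Lab & arity s -> state}
}.

Section Relations.
Context {disp : Order.disp_t} {D : preorderType disp} {Lab : choiceType}.
Context {X : session_coalgebra D Lab}.

Definition node (s : session_op D Lab) (f : arity s -> X) :
    {s : session_op D Lab & arity s -> X} :=
  existT (fun s => arity s -> X) s f.

Definition sigma (x : X) : session_op D Lab := projT1 (step x).
Definition delta (x : X) : arity (sigma x) -> X := projT2 (step x).

Inductive bisim_step (R : X -> X -> Prop) (x y : X) : Prop :=
| bisim_same s f g of
    step x = @node s f & step y = @node s g & (forall a, R (f a) (g a))
| bisim_bsc d d' of
    sigma x = Bsc d & sigma y = Bsc d' & d <= d' & d' <= d.

Definition bisimilar : X -> X -> Prop := greatest bisim_step.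

(* Closure is required under continuation transitions only.  If transmitted
   types had to belong to Y as well, [par] would fail on nearly every state
   that reaches a communication, and would not be invariant under [similar]. *)
Definition parallelizable (Y : X -> Prop) : Prop :=
  (forall u (a : arity (sigma u)), Y u -> is_continuation a -> Y (delta a)) /\
  (forall u w, Y u -> Y w -> bisimilar u w \/ sigma u = Par \/ sigma w = Par).

Inductive continuations (x : X) : X -> Prop :=
| continuations_refl : continuations x x
| continuations_step u (a : arity (sigma u)) :
    continuations x u -> is_continuation a -> continuations x (delta a).

Definition par (x : X) : Prop := parallelizable (continuations x).

Inductive sim_step (R : X -> X -> Prop) (x y : X) : Prop :=
| sim_in f g of
    step x = @node (Com In) f & step y = @node (Com In) g &
    R (f Star) (g Star) & R (f One) (g One)
| sim_out f g of
    step x = @node (Com Out) f & step y = @node (Com Out) g &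
    R (f Star) (g Star) & R (g One) (f One)
| sim_branch_in L1 L2 f g of
    step x = @node (Branch In L1) f & step y = @node (Branch In L2) g &
    val L1 `<=` val L2 &
    (forall l (l1 : l \in val L1) (l2 : l \in val L2), R (f [` l1]) (g [` l2]))
| sim_branch_out L1 L2 f g of
    step x = @node (Branch Out L1) f & step y = @node (Branch Out L2) g &
    val L2 `<=` val L1 &
    (forall l (l1 : l \in val L1) (l2 : l \in val L2), R (f [` l1]) (g [` l2]))
| sim_bsc d d' of
    sigma x = Bsc d & sigma y = Bsc d' & d <= d'
| sim_end of
    sigma x = End & sigma y = End
| sim_par f g of
    step x = @node Par f & step y = @node Par g &
    R (f tt) (g tt) & (par (f tt) <-> par (g tt)).

Definition similar : X -> X -> Prop := greatest sim_step.

Inductive dual_step (R : X -> X -> Prop) (x y : X) : Prop :=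
| dual_com p f g of
    step x = @node (Com p) f & step y = @node (Com (dual_pol p)) g &
    R (f Star) (g Star) & bisimilar (f One) (g One)
| dual_branch p L f g of
    step x = @node (Branch p L) f & step y = @node (Branch (dual_pol p) L) g &
    (forall l, R (f l) (g l))
| dual_end of
    sigma x = End & sigma y = End
| dual_par f g of
    step x = @node Par f & step y = @node Par g & R (f tt) (g tt).

Definition duality : X -> X -> Prop := greatest dual_step.

Definition un (T : X) : bool :=
  match sigma T with Par | End | Bsc _ => true | _ => false end.
End Relations.

(* Raw syntax over a set V of variables; processes are not identified up to
   renaming of bound variables. *)
Inductive process (V Lab : choiceType) : Type :=
| POut of V & V & process V Lab                 (* x<y>.P, output of y on x *)
| PIn of V & V & process V Lab                  (* x(y).P *)
| PBranch of V & {fmap Lab -> process V Lab}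
| PSel of V & Lab & process V Lab
| PPar of process V Lab & process V Lab
| PRep of process V Lab
| PNil
| PRes of V & V & process V Lab.                (* (nu xy)P *)

Arguments PNil {V Lab}.

Section Typing.
Context {disp : Order.disp_t} {D : preorderType disp} {Lab V : choiceType}.
Context {X : session_coalgebra D Lab}.

Definition context := {fmap V -> X}.

Implicit Types (G : context) (x y : V) (T U : X) (P Q : process V Lab).

Definition un_context G : Prop := forall x T, G.[? x] = Some T -> un T.

(* [G.[x <- T]] overwrites an existing entry, so that "G, x : T" is
   [G.[x <- T]] together with the side condition [x \notin G].  In a split,
   freshness for G implies freshness for G1 and G2. *)
Inductive ctx_split : context -> context -> context -> Prop :=
| split_nil : ctx_split [fmap] [fmap] [fmap]
| split_both G G1 G2 x T : x \notin G -> un T -> ctx_split G G1 G2 ->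
    ctx_split G.[x <- T] G1.[x <- T] G2.[x <- T]
| split_left G G1 G2 x T : x \notin G -> ctx_split G G1 G2 ->
    ctx_split G.[x <- T] G1.[x <- T] G2
| split_right G G1 G2 x T : x \notin G -> ctx_split G G1 G2 ->
    ctx_split G.[x <- T] G1 G2.[x <- T].

Inductive typed : context -> process V Lab -> Prop :=
| T_Inact G : un_context G -> typed G PNil
| T_Res G x T y U P : x \notin G -> y \notin G.[x <- T] ->
    typed G.[x <- T].[y <- U] P -> duality T U ->
    typed G (PRes x y P)
| T_Par G G1 G2 P Q : ctx_split G G1 G2 ->
    typed G1 P -> typed G2 Q ->
    typed G (PPar P Q)
| T_Rep G P : typed G P -> un_context G -> typed G (PRep P)
| T_In G x T y U P f : x \notin G ->
    step T = @node _ _ _ X (Com In) f ->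
    y \notin G -> x \notin G.[y <- U] ->
    typed G.[y <- U].[x <- f Star] P -> similar (f One) U ->
    typed G.[x <- T] (PIn x y P)
| T_Out G x T y U P f : x \notin G -> y \notin G.[x <- T] ->
    step T = @node _ _ _ X (Com Out) f ->
    typed G.[x <- f Star] P -> similar U (f One) ->
    typed G.[x <- T].[y <- U] (POut x y P)
| T_Branch G x T L1 f (Ps : {fmap Lab -> process V Lab}) : x \notin G ->
    step T = @node _ _ _ X (Branch In L1) f ->
    val L1 `<=` domf Ps ->
    (forall l (l1 : l \in val L1) (l2 : l \in domf Ps),
       typed G.[x <- f [` l1]] Ps.[l2]) ->
    typed G.[x <- T] (PBranch x Ps)
| T_Sel G x T L f l (lL : l \in val L) P : x \notin G ->
    step T = @node _ _ _ X (Branch Out L) f ->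
    typed G.[x <- f [` lL]] P ->
    typed G.[x <- T] (PSel x l P)
| T_Unpack G x T f P : x \notin G ->
    step T = @node _ _ _ X Par f -> par T ->
    typed G.[x <- f tt] P ->
    typed G.[x <- T] P.

Definition simulates (Delta Gamma : context) : Prop :=
  domf Delta = domf Gamma /\
  forall x T U, Delta.[? x] = Some T -> Gamma.[? x] = Some U -> similar T U.
End Typing.

Arguments context {disp D Lab} V X.

(* Main.v *)
(** The rules are syntax-directed up to (Unpack), so the derivation of
[Gamma |- P] can be replayed in [Delta], by induction.  A rule that constrains
the type of a channel constrains that of a subtype in the same way; the
premises that are subtypings are handled by transitivity.  For (Unpack), the
clause of similarity for [Par] carries parallelizability over to the
continuation of the subtype, and a [Par] state in front of a parallelizable
state is parallelizable. *)
Require Import Defs.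
From mathcomp Require Import all_boot all_order finmap.
From Stdlib Require Import Eqdep_dec.

Set Implicit Arguments.
Unset Strict Implicit.
Unset Printing Implicit Defensive.

Import Order.PreorderTheory.
Local Open Scope order_scope.
Local Open Scope fset_scope.
Local Open Scope fmap_scope.

(** * Similarity as a preorder, its inversion, and parallelizability of [Par] states *)

Section Similarity.
Context {disp : Order.disp_t} {D : preorderType disp} {Lab : choiceType}.
Context {X : session_coalgebra D Lab}.
Implicit Types (x y z : X) (s t : session_op D Lab).

(* Decidable equality of operations makes [node_inj] axiom-free. *)
Lemma session_op_comparable : comparable (session_op D Lab).
Proof.
move=> s t; rewrite /decidable; decide equality; try exact: eq_comparable.
all: by decide equality.
Qed.

Lemma node_inj s (f g : arity s -> X) : node f = node g -> f = g.
Proof. exact: (inj_pair2_eq_dec _ session_op_comparable). Qed.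

Lemma node_sigma s t (f : arity s -> X) (g : arity t -> X) :
  node f = node g -> s = t.
Proof. by move/(congr1 (@projT1 _ _)). Qed.

Lemma step_sigma x s (f : arity s -> X) : step x = node f -> sigma x = s.
Proof. by rewrite /sigma => ->. Qed.

(** Every clause uses the relation positively, even the output clause, which only swaps its
    arguments. This is what allows [similar] to be unfolded. *)
Lemma sim_step_mono (R S : X -> X -> Prop) x y :
  (forall u v, R u v -> S u v) -> sim_step R x y -> sim_step S x y.
Proof.
move=> RS [f g ? ? /RS ? /RS ?|f g ? ? /RS ? /RS ?|L1 L2 f g ? ? ? r
  |L1 L2 f g ? ? ? r|d d' ? ? ?|? ?|f g ? ? /RS ? ?].
- exact: (@sim_in _ _ _ _ _ _ _ f g).
- exact: (@sim_out _ _ _ _ _ _ _ f g).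
- by apply: (@sim_branch_in _ _ _ _ _ _ _ L1 L2 f g) => // *; apply: RS.
- by apply: (@sim_branch_out _ _ _ _ _ _ _ L1 L2 f g) => // *; apply: RS.
- exact: (@sim_bsc _ _ _ _ _ _ _ d d').
- exact: sim_end.
- exact: (@sim_par _ _ _ _ _ _ _ f g).
Qed.

Lemma similar_step x y : similar x y -> sim_step similar x y.
Proof. by case=> R RF /RF; apply: sim_step_mono => u v; exists R. Qed.

Lemma similar_refl x : similar x x.
Proof.
exists eq => // {x} x _ <-.
case E: (step x) => [[[]|[] L||d|] f].
- exact: (@sim_in _ _ _ _ _ _ _ f f).
- exact: (@sim_out _ _ _ _ _ _ _ f f).
(* The clause quantifies over two membership proofs of the same label, which have to be
   identified. *)
- apply: (@sim_branch_in _ _ _ _ _ _ _ L L f f) => // l l1 l2.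
  by rewrite (bool_irrelevance l1 l2).
- apply: (@sim_branch_out _ _ _ _ _ _ _ L L f f) => // l l1 l2.
  by rewrite (bool_irrelevance l1 l2).
- by apply: sim_end; rewrite /sigma E.
- by apply: (@sim_bsc _ _ _ _ _ _ _ d d); rewrite // /sigma E.
- exact: (@sim_par _ _ _ _ _ _ _ f f).
Qed.

(** The composite of [similar] with itself is a simulation; the intermediate witness is always a
    successor of [y]. *)
Lemma similar_trans y x z : similar x y -> similar y z -> similar x z.
Proof.
move=> xy yz; exists (fun u w => exists2 v, similar u v & similar v w);
  last by exists y.
move=> {x y z xy yz} x z [y /similar_step xy /similar_step yz].
case: xy => [f g xf yg r0 r1|f g xf yg r0 r1|L1 L2 f g xf yg sL r
  |L1 L2 f g xf yg sL r|d d' xd yd dd'|xe ye|f g xf yg r rp];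
case: yz => [g' h yg' zh q0 q1|g' h yg' zh q0 q1|M1 M2 g' h yg' zh sM q
  |M1 M2 g' h yg' zh sM q|e e' yd' ze ee'|ye' ze|g' h yg' zh q qp].
(* Both clauses describe [y], so all pairs of distinct clauses contradict each other. *)
all: try by move: yg'; rewrite yg => /node_sigma.
all: try by move: (step_sigma yg); congruence.
all: try by move: (step_sigma yg'); congruence.
all: try by congruence.
- move: yg'; rewrite yg => /node_inj gg'; rewrite -{}gg' in q0 q1.
  by apply: (@sim_in _ _ _ _ _ _ _ f h) => //;
    [exists (g Star) | exists (g One)].
- move: yg'; rewrite yg => /node_inj gg'; rewrite -{}gg' in q0 q1.
  by apply: (@sim_out _ _ _ _ _ _ _ f h) => //;
    [exists (g Star) | exists (g One)].
- move: yg'; rewrite yg => E; have [EL] := node_sigma E.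
  (* The type of [g'] depends on [M1], so the label sets are identified before the functions can be
     compared. *)
  case: M1 / EL g' E sM q => g' /node_inj <- sM q.
  apply: (@sim_branch_in _ _ _ _ _ _ _ L1 M2 f h) => //;
    first exact: fsubset_trans sM.
  by move=> l l1 l2; have lL := fsubsetP sL _ l1; exists (g [` lL]).
- move: yg'; rewrite yg => E; have [EL] := node_sigma E.
  case: M1 / EL g' E sM q => g' /node_inj <- sM q.
  apply: (@sim_branch_out _ _ _ _ _ _ _ L1 M2 f h) => //;
    first exact: fsubset_trans sL.
  by move=> l l1 l2; have lL := fsubsetP sM _ l2; exists (g [` lL]).
- move: yd'; rewrite yd => -[Ed]; rewrite -{}Ed in ee'.
  by apply: (@sim_bsc _ _ _ _ _ _ _ d e') => //; apply: le_trans ee'.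
- exact: sim_end.
- move: yg'; rewrite yg => /node_inj gg'; rewrite -{}gg' in q qp.
  apply: (@sim_par _ _ _ _ _ _ _ f h) => //; first by exists (g tt).
  by rewrite rp qp.
Qed.

Lemma similar_un x y : similar x y -> un y -> un x.
Proof.
move/similar_step; rewrite /un.
case=> [f g xf yg _ _|f g xf yg _ _|L1 L2 f g xf yg _ _|L1 L2 f g xf yg _ _
  |d d' -> ->|-> ->|f g xf yg _ _] //.
all: by rewrite (step_sigma xf) (step_sigma yg).
Qed.

(** This and the next four lemmas invert similarity from the supertype, whose type a typing rule
    constrains: the operation of [y] leaves one possible clause. *)
Lemma similar_com_in x y g : similar x y -> step y = @node _ _ _ X (Com In) g ->
  exists f, [/\ step x = @node _ _ _ X (Com In) f,
    similar (f Star) (g Star) & similar (f One) (g One)].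
Proof.
move=> /similar_step + yg; have ys := step_sigma yg.
case=> [f h xf|f h _|L1 L2 f h _|L1 L2 f h _|d d' _|_|f h _]; try congruence.
all: rewrite ?yg => // E; try by move: (node_sigma E).
by move/node_inj: E => <-; exists f.
Qed.

Lemma similar_com_out x y g :
  similar x y -> step y = @node _ _ _ X (Com Out) g ->
  exists f, [/\ step x = @node _ _ _ X (Com Out) f,
    similar (f Star) (g Star) & similar (g One) (f One)].
Proof.
move=> /similar_step + yg; have ys := step_sigma yg.
case=> [f h _|f h xf|L1 L2 f h _|L1 L2 f h _|d d' _|_|f h _]; try congruence.
all: rewrite ?yg => // E; try by move: (node_sigma E).
by move/node_inj: E => <-; exists f.
Qed.

Lemma similar_branch_in x y L2 g :
  similar x y -> step y = @node _ _ _ X (Branch In L2) g ->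
  exists L1 f, [/\ step x = @node _ _ _ X (Branch In L1) f,
    val L1 `<=` val L2 &
    forall l (l1 : l \in val L1) (l2 : l \in val L2),
      similar (f [` l1]) (g [` l2])].
Proof.
move=> /similar_step + yg; have ys := step_sigma yg.
case=> [f h _|f h _|L1 M2 f h xf|L1 M2 f h _|d d' _|_|f h _]; try congruence.
all: rewrite ?yg => // E; try by move: (node_sigma E).
have [EL] := node_sigma E.
by case: M2 / EL h E => h /node_inj <-; exists L1, f.
Qed.

Lemma similar_branch_out x y L2 g :
  similar x y -> step y = @node _ _ _ X (Branch Out L2) g ->
  exists L1 f, [/\ step x = @node _ _ _ X (Branch Out L1) f,
    val L2 `<=` val L1 &
    forall l (l1 : l \in val L1) (l2 : l \in val L2),
      similar (f [` l1]) (g [` l2])].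
Proof.
move=> /similar_step + yg; have ys := step_sigma yg.
case=> [f h _|f h _|L1 M2 f h _|L1 M2 f h xf|d d' _|_|f h _]; try congruence.
all: rewrite ?yg => // E; try by move: (node_sigma E).
have [EL] := node_sigma E.
by case: M2 / EL h E => h /node_inj <-; exists L1, f.
Qed.

Lemma similar_Par x y g : similar x y -> step y = @node _ _ _ X Par g ->
  exists f, [/\ step x = @node _ _ _ X Par f,
    similar (f tt) (g tt) & par (f tt) <-> par (g tt)].
Proof.
move=> /similar_step + yg; have ys := step_sigma yg.
case=> [f h _|f h _|L1 L2 f h _|L1 L2 f h _|d d' _|_|f h xf]; try congruence.
all: rewrite ?yg => // E; try by move: (node_sigma E).
by move/node_inj: E => <-; exists f.
Qed.

(** Labels of [delta] have type [arity (sigma x)], which is [unit] only up to a propositional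
    equality. Quantifying over these labels avoids transporting [tt]. *)
Lemma delta_Par x f : step x = @node _ _ _ X Par f ->
  (forall a : arity (sigma x), delta a = f tt) /\
  exists2 a : arity (sigma x), is_continuation a & delta a = f tt.
Proof.
rewrite /delta /sigma => ->; split=> /=; first by case.
by exists tt.
Qed.

Lemma continuations_Par x f u : step x = @node _ _ _ X Par f ->
  continuations x u <-> u = x \/ continuations (f tt) u.
Proof.
case/delta_Par=> dE [b cb db]; split.
- elim=> [|v a _ [vx|cv] ca]; first by left.
  + move: a ca; rewrite vx => a _; rewrite dE.
    by right; apply: continuations_refl.
  + by right; apply: continuations_step.
- case=> [->|]; first exact: continuations_refl.
  elim=> [|v a _ cv ca]; last exact: continuations_step.
  by rewrite -db; apply: continuations_step cb; apply: continuations_refl.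
Qed.

(** The only state that [x] may add to the continuations of [f tt] is [x] itself, and a pair
    containing a [Par] state is always admissible. *)
Lemma par_Par x f : step x = @node _ _ _ X Par f -> par x <-> par (f tt).
Proof.
move=> xf; have cP u := continuations_Par u xf.
split=> -[_ par_x]; split.
- exact: continuations_step.
- by move=> u w cu cw; apply: par_x; apply/cP; right.
- exact: continuations_step.
- move=> u w /cP[->|cu] /cP[->|cw]; try by right; rewrite (step_sigma xf); auto.
  exact: par_x.
Qed.

End Similarity.

(** * Simulation of contexts, and its compatibility with splitting and typing *)

Section Contexts.
Context {disp : Order.disp_t} {D : preorderType disp} {Lab V : choiceType}.
Context {X : session_coalgebra D Lab}.
Implicit Types (G : context V X) (x : V) (T U : X) (P : process V Lab).

Lemma simulates_set G G' x T T' : simulates G' G -> similar T' T ->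
  simulates G'.[x <- T'] G.[x <- T].
Proof.
move=> [dom sim] sT; split; first by rewrite !dom_setf dom.
move=> y U' U; rewrite !fnd_set; case: eqP => _; last exact: sim.
by move=> [<-] [<-].
Qed.

Lemma simulates_mem G G' x : simulates G' G -> (x \in G') = (x \in G).
Proof. by case=> /fsetP. Qed.

(** Puts a simulating context into the form of the conclusions of the rules: [H] is [G'] without
    [x], and [T'] is the entry removed. *)
Lemma simulates_setP G G' x T : x \notin G -> simulates G' G.[x <- T] ->
  exists H T', [/\ G' = H.[x <- T'], x \notin H, simulates H G
    & similar T' T].
Proof.
move=> xG simG; have [_ sim] := simG.
have xG' : x \in G' by rewrite (simulates_mem x simG) mem_setf inE eqxx.
exists G'.[~ x], G'.[xG'].
have sx : similar G'.[xG'] T by apply: (sim x); rewrite ?fnd_set ?eqxx ?in_fnd.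
split=> //.
- apply/fmapP => y; rewrite fnd_set fnd_rem1.
  by case: eqP => // ->; rewrite in_fnd.
- by rewrite mem_remf1 eqxx.
split.
  apply/fsetP=> y; rewrite mem_remf1 (simulates_mem y simG) mem_setf inE /=.
  by case: eqP => //= ->; rewrite (negPf xG).
move=> y T1 T2; rewrite fnd_rem1; case: eqP => // /eqP yx E1 E2.
by apply: (sim y) => //; rewrite fnd_set (negPf yx).
Qed.

Lemma simulates_un G G' : simulates G' G -> un_context G -> un_context G'.
Proof.
move=> [dom sim] unG x T ET.
have xG : x \in domf G by rewrite -dom -fndSome ET.
by apply: similar_un (sim x T G.[xG] ET _) (unG x _ _); rewrite in_fnd.
Qed.

(** Each entry goes to the same side as its supertype; a shared entry stays shareable by
    [similar_un]. *)
Lemma simulates_split G G1 G2 G' : ctx_split G G1 G2 -> simulates G' G ->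
  exists H1 H2, [/\ ctx_split G' H1 H2, simulates H1 G1 & simulates H2 G2].
Proof.
move=> spl; elim: spl G' => {G G1 G2} [|G G1 G2 x T xG unT _ IH
  |G G1 G2 x T xG _ IH|G G1 G2 x T xG _ IH] G'.
- move=> sim; have G'0 : G' = [fmap].
    by apply/fmapP => y; rewrite fnd_fmap0 not_fnd // (simulates_mem y sim).
  rewrite {}G'0 in sim *; exists [fmap], [fmap]; split=> //; exact: split_nil.
all: case/(simulates_setP xG) => H [T' [-> xH simH sT]].
all: have [H1 [H2 [spl sim1 sim2]]] := IH _ simH.
- exists H1.[x <- T'], H2.[x <- T']; split; try exact: simulates_set.
  by apply: split_both => //; apply: similar_un unT.
- exists H1.[x <- T'], H2; split=> //; [exact: split_left|].
  exact: simulates_set.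
- exists H1, H2.[x <- T']; split=> //; [exact: split_right|].
  exact: simulates_set.
Qed.

Lemma typed_simulates G G' P : typed G P -> simulates G' G -> typed G' P.
Proof.
move=> ty; elim: ty G' => {G P}.
- by move=> G unG G' sim; apply/T_Inact/(simulates_un sim).
- move=> G x T y U P xG yG _ IH dual G' sim.
  (* The restricted channels keep their types, so the duality premise is reused as it is. *)
  have simT := simulates_set x sim (similar_refl T).
  rewrite -(simulates_mem x sim) in xG; rewrite -(simulates_mem y simT) in yG.
  apply: (T_Res xG yG) dual.
  by apply: IH; apply: simulates_set (similar_refl U).
- move=> G G1 G2 P Q /simulates_split spl _ IH1 _ IH2 G' /spl.
  by move=> [H1 [H2 [splH /IH1 ty1 /IH2 ty2]]]; apply: T_Par splH _ _.
- move=> G P _ IH unG G' sim.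
  by apply: T_Rep; [apply: IH | apply: simulates_un unG].
- move=> G x T y U P f xG Tf yG xGU _ IH fU G'.
  case/(simulates_setP xG) => H [T' [-> xH sim sT]].
  have [f' [Tf' s0 s1]] := similar_com_in sT Tf.
  have simU := simulates_set y sim (similar_refl U).
  rewrite -(simulates_mem y sim) in yG; rewrite -(simulates_mem x simU) in xGU.
  apply: (T_In xH Tf' yG xGU).
    by apply: IH; apply: simulates_set.
  (* The chain is [f' One], [f One], [U]. *)
  exact: similar_trans fU.
- move=> G x T y U P f xG yG Tf _ IH Uf G'.
  case/(simulates_setP yG) => H [U' [-> yH simH sU]].
  case/(simulates_setP xG): simH yH => K [T' [-> xK sim sT]] yK.
  have [f' [Tf' s0 s1]] := similar_com_out sT Tf.
  apply: (T_Out xK yK Tf'); first by apply: IH; apply: simulates_set.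
  (* The chain is [U'], [U], [f One], [f' One]; its last link is the contravariance of outputs. *)
  exact: similar_trans sU (similar_trans Uf s1).
- move=> G x T L f Ps xG Tf LP _ IH G'.
  case/(simulates_setP xG) => H [T' [-> xH sim sT]].
  have [L' [f' [Tf' LL s]]] := similar_branch_in sT Tf.
  apply: (T_Branch xH Tf'); first exact: fsubset_trans LP.
  (* The subtype has no labels beyond those of [L], so each required branch is already typed. *)
  move=> l l1 l2; have lL := fsubsetP LL _ l1.
  by apply: (IH l lL l2); apply: simulates_set.
- move=> G x T L f l lL P xG Tf _ IH G'.
  case/(simulates_setP xG) => H [T' [-> xH sim sT]].
  have [L' [f' [Tf' LL s]]] := similar_branch_out sT Tf.
  have lL' := fsubsetP LL _ lL.
  apply: (T_Sel (lL := lL') xH Tf').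
  by apply: IH; apply: simulates_set.
- move=> G x T f P xG Tf parT _ IH G'.
  case/(simulates_setP xG) => H [T' [-> xH sim sT]].
  have [f' [Tf' s sp]] := similar_Par sT Tf.
  apply: (T_Unpack xH Tf'); last by apply: IH; apply: simulates_set.
  (* Parallelizability passes from [T] to [f tt], across similarity to [f' tt], and back up to
     [T']. *)
  by apply/(par_Par Tf')/sp/(par_Par Tf).
Qed.

End Contexts.

Theorem theorem5 (disp : Order.disp_t) (D : preorderType disp)
    (Lab V : choiceType) (X : session_coalgebra D Lab)
    (Gamma Delta : context V X) (P : process V Lab) :
  simulates Delta Gamma -> typed Gamma P -> typed Delta P.
Proof. by move=> sim ty; apply: typed_simulates ty sim. Qed.
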